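(* For every integer $D\ge 3$, the set of graphs with a two-way infinite bridge is meager in $\mathfrak{G}^{\bullet,\infty}_{\le D}$, and the set of graphs with a two-way infinite bridge is meager in $\mathfrak{G}^{\bullet,\infty}_{=D}$.
   Context: Graphs are simple. For an integer $D\ge 3$, $\mathfrak{G}^{\bullet}_{\le D}$ is the set of connected rooted graphs $(G,x)$ of maximum degree at most $D$, up to root-preserving isomorphism. $\mathfrak{G}^{\bullet,\infty}_{\le D}$ is the subset of those with $G$ infinite, and $\mathfrak{G}^{\bullet,\infty}_{=D}$ is the subset of those with $G$ infinite and every vertex of degree exactly $D$. For $r\ge 0$, $B_r(G,x)$ is the subgraph of $G$ induced by the vertices at distance at most $r$ from $x$, rooted at $x$. The metric is $d^{\bullet}((G_1,v_1),(G_2,v_2))=\inf\{2^{-r} : B_r(G_1,v_1)\cong B_r(G_2,v_2)\}$ (root-preserving isomorphism); subsets carry the restricted metric. A subset $S$ of a space $X$ is nowhere dense in $X$ if every non-empty open $U\subseteq X$ contains a non-empty open $U'\subseteq U$ with $U'\cap S=\emptyset$; it is meager in $X$ if it is a countable union of nowhere dense sets. An edge $e$ of an infinite connected graph $G$ is a bridge if $G-e$ is disconnected. A bridge is two-way infinite if both components of $G-e$ are infinite. *)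

(* Defs.v *)
From HB Require Import structures.
From mathcomp Require Import all_boot all_order all_algebra.
From mathcomp Require Import all_classical all_reals all_analysis.

Set Implicit Arguments.
Unset Strict Implicit.
Unset Printing Implicit Defensive.

Import Order.TTheory GRing.Theory Num.Theory.

Local Open Scope classical_set_scope.
Local Open Scope card_scope.
Local Open Scope quotient_scope.
Local Open Scope ring_scope.

Definition nowhere_dense (X : topologicalType) (S : set X) : Prop :=
  forall U : set X, open U -> U !=set0 ->
  exists U' : set X, [/\ open U', U' !=set0, U' `<=` U & U' `&` S = set0].

Definition meager (X : topologicalType) (S : set X) : Prop :=
  exists F : nat -> set X,
    (forall n, nowhere_dense (F n)) /\ S = \bigcup_n F n.

Record graph := Graph {
  vert :> Type;
  adj : vert -> vert -> Prop;
  adj_sym : forall x y, adj x y -> adj y x;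
  adj_irrefl : forall x, ~ adj x x }.

Definition neighbors (G : graph) (x : G) : set G := [set y | adj x y].

Fixpoint walk (G : graph) (n : nat) (x y : G) : Prop :=
  if n is m.+1 then exists2 z, walk m x z & adj z y else x = y.

Definition dist_le (G : graph) (r : nat) (x y : G) : Prop :=
  exists2 n, (n <= r)%N & walk n x y.

Definition component (G : graph) (x : G) : set G := [set y | exists n, walk n x y].

Definition connected_graph (G : graph) : Prop := forall x y : G, component x y.

Definition infinite_graph (G : graph) : Prop := infinite_set [set: G].

Definition max_degree_le (D : nat) (G : graph) : Prop :=
  forall x : G, neighbors x #<= `I_D.

Definition regular (D : nat) (G : graph) : Prop :=
  forall x : G, neighbors x #= `I_D.

Section induced.
Variables (G : graph) (A : set G).

(* The vertex type is sig rather than the library's set_type, whose fixed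
   universe level would exclude graphs as elements of a choiceType. *)
Definition induced_vert : Type := {x : G | A x}.

Definition induced_adj (x y : induced_vert) : Prop := adj (sval x) (sval y).

Lemma induced_sym x y : induced_adj x y -> induced_adj y x.
Proof. exact: adj_sym. Qed.

Lemma induced_irrefl x : ~ induced_adj x x.
Proof. exact: adj_irrefl. Qed.

Definition induced := Graph induced_sym induced_irrefl.
End induced.

Section delete_edge.
Variables (G : graph) (u v : G).

Definition del_adj (x y : G) : Prop :=
  adj x y /\ ~ (x = u /\ y = v \/ x = v /\ y = u).

Lemma del_sym x y : del_adj x y -> del_adj y x.
Proof. by move=> [xy nuv]; split; [exact: adj_sym|tauto]. Qed.

Lemma del_irrefl x : ~ del_adj x x.
Proof. by move=> [/adj_irrefl]. Qed.

Definition del_edge := Graph del_sym del_irrefl.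
End delete_edge.

Definition bridge (G : graph) (u v : G) : Prop :=
  adj u v /\ ~ connected_graph (del_edge u v).

Definition two_way_infinite_bridge (G : graph) (u v : G) : Prop :=
  bridge u v /\ forall x : del_edge u v, infinite_set (component x).

Definition has_two_way_infinite_bridge (G : graph) : Prop :=
  exists u v : G, two_way_infinite_bridge u v.

Record rgraph := RGraph { rgraph_graph :> graph; root : rgraph_graph }.

Definition iso (G H : rgraph) : Prop :=
  exists f : G -> H, [/\ bijective f,
    forall x y, adj x y <-> adj (f x) (f y) & f (root G) = root H].

Definition ball_set (r : nat) (G : rgraph) : set G := [set x | dist_le r (root G) x].

Lemma root_in_ball (r : nat) (G : rgraph) : ball_set r (root G).
Proof. by exists 0%N. Qed.

Definition rball (r : nat) (G : rgraph) : rgraph :=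
  @RGraph (induced (@ball_set r G)) (exist _ (root G) (root_in_ball r G)).

Lemma iso_refl G : iso G G.
Proof. by exists id; split => //; exists id. Qed.

Lemma iso_sym G H : iso G H -> iso H G.
Proof.
move=> [f [[g fK gK] fadj fr]]; exists g; split; first by exists f.
  by move=> x y; rewrite fadj !gK.
by rewrite -fr fK.
Qed.

Lemma iso_trans G H K : iso G H -> iso H K -> iso G K.
Proof.
move=> [f [fb fadj fr]] [g [gb gadj gr]]; exists (g \o f); split.
- exact: bij_comp.
- by move=> x y; rewrite fadj gadj.
- by rewrite /= fr gr.
Qed.

(* A root-preserving isomorphism between the balls of radius r, given by total
   maps which are only constrained on these balls. *)
Definition ball_iso (r : nat) (G H : rgraph) (f : G -> H) (g : H -> G) : Prop :=
  [/\ forall x, ball_set r x -> ball_set r (f x) /\ g (f x) = x,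
      forall y, ball_set r y -> ball_set r (g y) /\ f (g y) = y,
      forall x y, ball_set r x -> ball_set r y -> adj x y <-> adj (f x) (f y)
    & f (root G) = root H].

Lemma ball_isoP r G H :
  iso (rball r G) (rball r H) <-> exists f g, @ball_iso r G H f g.
Proof.
have vinj (K : rgraph) (x y : rball r K) : sval x = sval y -> x = y.
  exact: eq_sig_hprop.
split.
  move=> [f [[g fK gK] fadj fr]].
  pose ext (K L : rgraph) (h : rball r K -> rball r L) (x : K) : L :=
    if pselect (ball_set r x) is left p then sval (h (exist _ x p))
    else root L.
  have extE (K L : rgraph) h (x : rball r K) : ext K L h (sval x) = sval (h x).
    rewrite /ext; case: pselect => [p|[]]; last exact: (svalP x).
    by congr (sval (h _)); apply: vinj.
  have lft (K : rgraph) (x : K) : ball_set r x -> exists x' : rball r K, x = sval x'.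
    by move=> p; exists (exist _ x p).
  have vb (K : rgraph) (x : rball r K) : ball_set r (sval x) by exact: svalP.
  exists (ext G H f), (ext H G g); split.
  - by move=> _ /lft[x ->]; rewrite !extE fK; split=> //; exact: vb.
  - by move=> _ /lft[x ->]; rewrite !extE gK; split=> //; exact: vb.
  - by move=> _ _ /lft[x ->] /lft[y ->]; rewrite !extE; exact: fadj.
  - by have := extE _ _ f (root (rball r G)); rewrite fr.
move=> [f [g [fP gP fadj fr]]].
pose res (K L : rgraph) (h : K -> L)
  (hb : forall x, ball_set r x -> ball_set r (h x)) (x : rball r K) :
  rball r L := exist _ (h (sval x)) (hb _ (svalP x)).
exists (res G H f (fun x p => (fP x p).1)); split.
- exists (res H G g (fun x p => (gP x p).1)) => x; apply: vinj => /=.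
    by have [] := fP _ (svalP x).
  by have [] := gP _ (svalP x).
- by move=> x y; exact: (fadj _ _ (svalP x) (svalP y)).
- exact: vinj.
Qed.

Lemma ball_set_mono s r (G : rgraph) (x : G) : (s <= r)%N -> ball_set s x -> ball_set r x.
Proof. by move=> sr [n ns w]; exists n => //; exact: leq_trans sr. Qed.

Lemma ball_iso_sym r G H f g : @ball_iso r G H f g -> @ball_iso r H G g f.
Proof.
move=> [fP gP fadj fr]; split=> //.
  move=> x y bx by_; have [bgx fgx] := gP _ bx; have [bgy fgy] := gP _ by_.
  by rewrite (fadj (g x) (g y)) // fgx fgy.
by rewrite -fr (fP _ _).2 //; exists 0%N.
Qed.

Lemma ball_iso_walk r G H f g n x : (n <= r)%N -> @ball_iso r G H f g ->
  walk n (root G) x -> walk n (root H) (f x).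
Proof.
move=> + [fP gP fadj fr]; elim: n x => [|n IHn] x nr /=; first by move=> <-.
move=> [z wz zx]; exists (f z); first by apply: IHn => //; exact: ltnW.
apply/(fadj z x) => //; first by exists n => //; exact: ltnW.
by exists n.+1 => //; exists z.
Qed.

Lemma ball_iso_ball s r G H f g x : (s <= r)%N -> @ball_iso r G H f g ->
  ball_set s x -> ball_set s (f x).
Proof.
move=> sr fg [n ns w]; exists n => //.
by apply: (ball_iso_walk _ fg) => //; exact: leq_trans sr.
Qed.

Lemma ball_iso_mono s r G H f g :
  (s <= r)%N -> @ball_iso r G H f g -> @ball_iso s G H f g.
Proof.
move=> sr fg; have gf := ball_iso_sym fg; case: (fg) => fP gP fadj fr.
split=> //.
- move=> x bx; split; first exact: (ball_iso_ball sr fg).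
  by have [] := fP x (ball_set_mono sr bx).
- move=> y by_; split; first exact: (ball_iso_ball sr gf).
  by have [] := gP y (ball_set_mono sr by_).
- by move=> x y bx by_; apply: fadj; exact: ball_set_mono sr _.
Qed.

Lemma iso_ball_mono s r G H :
  (s <= r)%N -> iso (rball r G) (rball r H) -> iso (rball s G) (rball s H).
Proof.
move=> sr /ball_isoP[f [g fg]]; apply/ball_isoP; exists f, g.
exact: ball_iso_mono fg.
Qed.

Lemma iso_ball r G H : iso G H -> iso (rball r G) (rball r H).
Proof.
move=> [f [[g fK gK] fadj fr]]; apply/ball_isoP; exists f, g.
have gr : g (root H) = root G by rewrite -fr fK.
have walk_map (K L : rgraph) (h : K -> L) n : h (root K) = root L ->
    (forall x y, adj x y -> adj (h x) (h y)) ->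
    forall x, walk n (root K) x -> walk n (root L) (h x).
  move=> hr hadj; elim: n => [|n IHn] x /=; first by move=> <-.
  by move=> [z wz zx]; exists (h z); [exact: IHn|exact: hadj].
split=> //.
- move=> x [n nr w]; split=> //; exists n => //.
  by apply: walk_map w => // ? ? /fadj.
- move=> y [n nr w]; split=> //; exists n => //.
  by apply: walk_map w => // ? ? ?; apply/fadj; rewrite !gK.
Qed.

Definition rgraph_dist (R : realType) (G H : rgraph) : R :=
  inf [set 2 ^- r | r in [set r | iso (rball r G) (rball r H)]].

Section rgraph_dist.
Variable R : realType.
Implicit Types G H K : rgraph.
Let S G H : set R := [set 2 ^- r | r in [set r | iso (rball r G) (rball r H)]].

Lemma iso_ball0 G H : iso (rball 0 G) (rball 0 H).
Proof.
apply/ball_isoP; exists (fun=> root H), (fun=> root G).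
have b0 (K : rgraph) (x : K) : ball_set 0 x <-> x = root K.
  split=> [[n]|->]; last by exists 0%N.
  by rewrite leqn0 => /eqP-> /= ->.
split=> //; try by move=> x /b0->; split=> //; exact/b0.
by move=> x y /b0-> /b0->; split=> /adj_irrefl.
Qed.

Let S_inf G H : has_inf (S G H).
Proof.
split; first by exists (2 ^- 0), 0%N => //; exact: iso_ball0.
by exists 0 => _ [r _ <-]; rewrite invr_ge0 exprn_ge0.
Qed.

Lemma rgraph_dist_le G H r :
  iso (rball r G) (rball r H) -> rgraph_dist R G H <= 2 ^- r.
Proof. by move=> i; apply: ge_inf; [exact: (S_inf G H).2|exists r]. Qed.

Lemma rgraph_dist_lt G H e : rgraph_dist R G H < e ->
  exists2 r, 2 ^- r < e & iso (rball r G) (rball r H).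
Proof. by move=> /(inf_lt (S_inf G H).1)[_ [r i <-] re]; exists r. Qed.

Lemma rgraph_dist_ge0 G H : 0 <= rgraph_dist R G H.
Proof.
apply: lb_le_inf; first exact: (S_inf G H).1.
by move=> _ [r _ <-]; rewrite invr_ge0 exprn_ge0.
Qed.

Lemma rgraph_dist_eq0 G H : rgraph_dist R G H = 0 <->
  forall r, iso (rball r G) (rball r H).
Proof.
split=> [d0 r|i].
  have : rgraph_dist R G H < 2 ^- r by rewrite d0 invr_gt0 exprn_gt0.
  move=> /rgraph_dist_lt[s sr]; apply: iso_ball_mono.
  rewrite leqNgt; apply/negP => rs; move: sr; apply/negP; rewrite -leNgt.
  by rewrite lef_pV2 ?posrE ?exprn_gt0// ler_eXn2l ?ltr1n// ltnW.
apply/eqP; rewrite eq_le rgraph_dist_ge0 andbT; apply/ler_addgt0Pl => e e0.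
rewrite addr0; have [r re] : exists r, 2 ^- r < e.
  exists (Num.bound e^-1); rewrite invf_plt ?posrE ?exprn_gt0//.
  apply: (lt_trans (archi_boundP _)); first by rewrite invr_ge0 ltW.
  by rewrite -natrX ltr_nat ltn_expl.
exact: le_trans (rgraph_dist_le (i r)) (ltW re).
Qed.

Lemma rgraph_dist_sym G H : rgraph_dist R G H = rgraph_dist R H G.
Proof.
congr inf; apply/seteqP; split=> _ [r i <-]; exists r => //; exact: iso_sym.
Qed.

Lemma rgraph_dist_triangle H G K :
  rgraph_dist R G K <= rgraph_dist R G H + rgraph_dist R H K.
Proof.
apply/ler_addgt0Pl => e e0.
have e20 : 0 < e / 2 by rewrite divr_gt0.
have /rgraph_dist_lt[r re rGH] :
  rgraph_dist R G H < rgraph_dist R G H + e / 2 by rewrite ltrDl.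
have /rgraph_dist_lt[s se sHK] :
  rgraph_dist R H K < rgraph_dist R H K + e / 2 by rewrite ltrDl.
rewrite [e]splitr addrC addrACA.
have rs : iso (rball (minn r s) G) (rball (minn r s) K).
  apply: (@iso_trans _ (rball (minn r s) H)).
  - by apply: iso_ball_mono rGH; exact: geq_minl.
  - by apply: iso_ball_mono sHK; exact: geq_minr.
apply: (le_trans (rgraph_dist_le rs)).
have p (n : nat) : 0 <= 2 ^- n :> R by rewrite invr_ge0 exprn_ge0.
have d0 := rgraph_dist_ge0.
rewrite /minn; case: ifP => _.
  by apply: (le_trans (ltW re)); rewrite lerDl addr_ge0// ltW.
by apply: (le_trans (ltW se)); rewrite lerDr addr_ge0// ltW.
Qed.

End rgraph_dist.

Record crgraph (D : nat) := CRGraph {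
  crgraph_rgraph :> rgraph;
  crgraph_connected : connected_graph crgraph_rgraph;
  crgraph_degree : max_degree_le D crgraph_rgraph }.

Lemma crgraph_ball_finite D (G : crgraph D) r : finite_set (@ball_set r G).
Proof.
have neighbors_finite (x : G) : finite_set (neighbors x).
  exact: card_le_finite (crgraph_degree x) (finite_II D).
elim: r => [|r IHr].
  apply: (sub_finite_set _ (finite_set1 (root G))) => x [n].
  by rewrite leqn0 => /eqP-> /= ->.
apply: (@sub_finite_set _ _ (@ball_set r G `|`
  \bigcup_(x in @ball_set r G) neighbors x)).
  move=> x [n nr w]; move: nr; rewrite leq_eqVlt => /predU1P[nr|nr].
    move: w; rewrite {}nr => -[z wz zx]; right; exists z => //.
    by exists r.
  by left; exists n.
by rewrite finite_setU; split=> //; exact: bigcup_finite.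
Qed.

Lemma ultra_finite (T : Type) (F : set_system nat) (f : nat -> T) (A : set T) :
  UltraFilter F -> finite_set A -> F [set r | A (f r)] ->
  exists y, F [set r | f r = y].
Proof.
move=> FU /(@finite_seqP {classic T})[s ->].
elim: s => [|a s IHs] /= Fs; first by have [] := filter_ex Fs.
have [Fa|Fna] := in_ultra_setVsetC [set r | f r = a] FU; first by exists a.
apply: IHs; apply: filterS (filterI Fs Fna) => r [] /=.
by rewrite inE => /predU1P[].
Qed.

Lemma iso_of_balls D (G H : crgraph D) :
  (forall r, iso (rball r G) (rball r H)) -> iso G H.
Proof.
move=> i.
have ex : forall r,
    exists fg : (G -> H) * (H -> G), ball_iso r fg.1 fg.2.
  by move=> r; have /ball_isoP[f [g fgr]] := i r; exists (f, g).
have [fg fgP] := boolp.choice ex.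
have [F [FU Foo]] := ultraFilterLemma (eventually_filter).
have FN0 (P : Prop) : (\forall r \near F, P) -> P.
  by move=> FP; have [] := filter_ex FP.
have in_ball (K : crgraph D) (x : K) : \forall r \near F, ball_set r x.
  have [n w] := crgraph_connected (root K) x.
  by apply: Foo; exists n => // m /= nm; exists n.
have lim (K L : crgraph D) (h : nat -> K -> L) (h' : nat -> L -> K) :
    (forall r, ball_iso r (h r) (h' r)) ->
    exists h0 : K -> L, forall x, \forall r \near F, h r x = h0 x.
  move=> hP; suff /boolp.choice[h0 h0P] :
      forall x, exists y, \forall r \near F, h r x = y by exists h0.
  move=> x.
  have [n w] := crgraph_connected (root K) x.
  apply: (ultra_finite FU (crgraph_ball_finite L n)).
  apply: Foo; exists n => // m /= nm.
  by apply: ball_iso_ball (hP m) _ => //; exists n.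
have [f fP] := lim _ _ _ _ fgP.
have [g gP] := lim _ _ _ _ (fun r => ball_iso_sym (fgP r)).
exists f; split.
- exists g => [x|y].
    apply: FN0.
    apply: filterS3 (in_ball _ x) (fP x) (gP (f x)) => r xr <- <-.
    by have [/(_ _ xr)[]] := fgP r.
  apply: FN0.
  apply: filterS3 (in_ball _ y) (gP y) (fP (g y)) => r yr <- <-.
  by have [_ /(_ _ yr)[]] := fgP r.
- move=> x y; apply: FN0.
  apply: filterS2 (filterI (in_ball _ x) (in_ball _ y)) (filterI (fP x) (fP y)).
  by move=> r [xr yr] [<- <-]; have [_ _ /(_ x y xr yr)] := fgP r.
- apply: FN0.
  by apply: filterS (fP (root G)) => r <-; have [] := fgP r.
Qed.

HB.instance Definition _ D := gen_eqMixin (crgraph D).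
HB.instance Definition _ D := gen_choiceMixin (crgraph D).

Definition crgraph_iso D : rel (crgraph D) := fun G H => `[< iso G H >].

Lemma crgraph_iso_refl D : reflexive (@crgraph_iso D).
Proof. by move=> G; apply/asboolP; exact: iso_refl. Qed.

Lemma crgraph_iso_sym D : symmetric (@crgraph_iso D).
Proof. by move=> G H; apply/asboolP/asboolP; exact: iso_sym. Qed.

Lemma crgraph_iso_trans D : transitive (@crgraph_iso D).
Proof.
by move=> H G K /asboolP GH /asboolP HK; apply/asboolP; exact: iso_trans HK.
Qed.

Canonical crgraph_iso_equiv D := EquivRel (@crgraph_iso D)
  (@crgraph_iso_refl D) (@crgraph_iso_sym D) (@crgraph_iso_trans D).
Canonical crgraph_iso_enc D := defaultEncModRel (@crgraph_iso D).

(* Connected rooted graphs of maximum degree at most D up to isomorphism.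
   R is only the field in which the distance takes its values. *)
Definition rooted_graphs (R : realType) (D : nat) : Type :=
  {eq_quot @crgraph_iso D}.

HB.instance Definition _ R D := Choice.on (rooted_graphs R D).
HB.instance Definition _ R D := Quotient.on (rooted_graphs R D).

Section metric.
Variables (R : realType) (D : nat).
Implicit Types x y z : rooted_graphs R D.

Lemma rooted_graphs_eqP (G H : crgraph D) :
  \pi_(rooted_graphs R D) G = \pi_(rooted_graphs R D) H <-> iso G H.
Proof.
by split=> [/eqmodP/asboolP|i]; last by apply/eqmodP/asboolP.
Qed.

Definition rooted_dist x y : R := rgraph_dist R (repr x) (repr y).

Let dist_xx x : rooted_dist x x = 0.
Proof. by apply/rgraph_dist_eq0 => r; exact: iso_refl. Qed.

Let dist_positivity x y : rooted_dist x y = 0 -> x = y.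
Proof.
move=> /rgraph_dist_eq0/iso_of_balls i; rewrite -(reprK x) -(reprK y).
exact/rooted_graphs_eqP.
Qed.

Let dist_sym x y : rooted_dist x y = rooted_dist y x.
Proof. exact: rgraph_dist_sym. Qed.

Let dist_triangle y x z : rooted_dist x z <= rooted_dist x y + rooted_dist y z.
Proof. exact: rgraph_dist_triangle. Qed.

HB.instance Definition _ := @isMetric.Build R (rooted_graphs R D)
  rooted_dist dist_xx dist_positivity dist_sym dist_triangle.

Lemma mdist_pi (G H : crgraph D) :
  mdist (\pi_(rooted_graphs R D) G) (\pi_(rooted_graphs R D) H) =
  rgraph_dist R G H.
Proof.
have riso (K : crgraph D) : iso (repr (\pi_(rooted_graphs R D) K)) K.
  by apply/rooted_graphs_eqP; rewrite reprK.
congr inf; apply/seteqP; split=> _ [r i <-]; exists r => //.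
  apply: iso_trans (iso_trans i (iso_ball r (riso H))).
  exact/iso_ball/iso_sym.
apply: iso_trans (iso_trans i (iso_ball r (iso_sym (riso H)))).
exact: iso_ball.
Qed.

(* The graph properties imposed on representatives below are invariant under
   isomorphism. *)
Definition representative (c : rooted_graphs R D) : crgraph D := repr c.

Definition infinite_rooted_graphs : set (rooted_graphs R D) :=
  [set c | infinite_graph (representative c)].

Definition infinite_regular_rooted_graphs : set (rooted_graphs R D) :=
  [set c | infinite_graph (representative c) /\ regular D (representative c)].

(* X carries the subspace topology of set_type. *)
Definition with_two_way_infinite_bridge (X : set (rooted_graphs R D)) : set X :=
  [set c : X | has_two_way_infinite_bridge (representative (\val c))].

End metric.

Arguments infinite_rooted_graphs : clear implicits.
Arguments infinite_regular_rooted_graphs : clear implicits.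
Arguments with_two_way_infinite_bridge [R D] X _.

(* Main.v *)
Require Import Defs.
From mathcomp Require Import all_boot all_order all_algebra.
From mathcomp Require Import all_classical all_reals all_analysis.
From mathcomp Require Import zify.

(* Graphs with a two-way infinite bridge whose ends lie in the ball of radius n
   around the root form a nowhere dense set. That an edge is not a two-way
   infinite bridge is visible in a finite ball, since it is witnessed by a
   finite path avoiding the edge or by a finite component. So it suffices to
   find, for every infinite G and every r, a graph H in the same space with the
   same r-ball B and no two-way infinite bridge inside B. To build H, take the
   D-regular bipartite graph on Z * {0, 1} joining (i, 0) to (i + c, 1) for
   c < D, and exchange every edge xy of G leaving B, with its own index i, and
   the edge from (i, 0) to (i + 2, 1) for the edges from x to (i, 0) and from y
   to (i + 2, 1). All degrees are preserved. The edges with c < 2 keep the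
   bipartite graph connected, and every vertex of G outside B is joined to it
   without edges inside B. Hence, after an edge inside B is removed, every
   component that misses the bipartite graph lies in the finite set B. *)

Set Implicit Arguments.
Unset Strict Implicit.
Unset Printing Implicit Defensive.

Import Order.TTheory GRing.Theory Num.Theory.

Local Open Scope classical_set_scope.
Local Open Scope card_scope.
Local Open Scope quotient_scope.
Local Open Scope ring_scope.

(** * Walks and components *)

Section walks.
Variable G : graph.
Implicit Types x y z : G.

Lemma walk_cat m n x y z : walk m x y -> walk n y z -> walk (m + n) x z.
Proof.
move=> xy; elim: n z => [|n IHn] z /=; first by rewrite addn0 => <-.
by rewrite addnS => -[t yt tz]; exists t => //; exact: IHn.
Qed.

Lemma walk_sym n x y : walk n x y -> walk n y x.
Proof.
elim: n y => [//|n IHn] y [z xz zy].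
by rewrite -add1n; apply: walk_cat (IHn _ xz); exists y => //; exact: adj_sym.
Qed.

Lemma component_refl x : component x x.
Proof. by exists 0%N. Qed.

Lemma component_sym x y : component x y -> component y x.
Proof. by move=> [n /walk_sym]; exists n. Qed.

Lemma component_trans y x z : component x y -> component y z -> component x z.
Proof. by move=> [m xy] [n yz]; exists (m + n)%N; exact: walk_cat yz. Qed.

Lemma adj_component x y : adj x y -> component x y.
Proof. by move=> xy; exists 1%N; exists x. Qed.

Lemma component_sub (A : set G) x : A x ->
  (forall y z, A y -> adj y z -> A z) -> component x `<=` A.
Proof.
move=> Ax Aadj y [n]; elim: n y => [y <- //|n IHn y [z /IHn Az /Aadj]]; exact.
Qed.

End walks.

(** If the ends stayed joined after the removal, every passage of a walk through the edge could be
    rerouted, and the graph would remain connected. *)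
Lemma bridge_separates (G : graph) (u v : G) : connected_graph G ->
  bridge u v -> ~ @component (del_edge u v) u v.
Proof.
move=> Gconn [uv nconn] cuv; apply: nconn => x y.
have [n] := Gconn x y; elim: n y => [y <-|n IHn y [z /IHn xz zy]].
  exact: component_refl.
apply: component_trans xz _.
have [[[-> ->]//|[-> ->]]|zyuv] := pselect (z = u /\ y = v \/ z = v /\ y = u).
  exact: component_sym.
exact: adj_component.
Qed.

(** * Exchanging cut edges with bipartite edges; degrees *)

Section cut_swap.
Variables (G : graph) (B : set G) (idx : G -> G -> int) (D : nat).

Definition cut_edge (x y : G) : Prop := [/\ B x, ~ B y & adj x y].

Hypothesis D3 : (3 <= D)%N.
Hypothesis idx_inj : forall x y x' y', cut_edge x y -> cut_edge x' y' ->
  idx x y = idx x' y' -> x = x' /\ y = y'.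

(* One orientation of the edges; [inr (i, b)] is the vertex (i, b) of the
   bipartite graph. *)
Definition swap_half (a b : G + int * bool) : Prop :=
  match a, b with
  | inl x, inl y => adj x y /\ (B x <-> B y)
  | inl x, inr (i, false) => exists2 y, cut_edge x y & idx x y = i
  | inl y, inr (j, true) => exists2 x, cut_edge x y & idx x y + 2 = j
  | inr (i, false), inr (j, true) => exists c : nat,
      [/\ (c < D)%N, j = i + c%:Z &
          c = 2 -> ~ exists x y, cut_edge x y /\ idx x y = i]
  | _, _ => False
  end.

Definition swap_adj a b := swap_half a b \/ swap_half b a.

Lemma swap_sym a b : swap_adj a b -> swap_adj b a.
Proof. by rewrite /swap_adj; tauto. Qed.

Lemma swap_irrefl a : ~ swap_adj a a.
Proof. by case: a => [x|[i []]] /= []//= [/adj_irrefl]. Qed.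

Definition cut_swap := Graph swap_sym swap_irrefl.

(** Each cut edge at [x] becomes one new edge at [x]; since [idx] is injective on cut edges, the new
    ends are distinct. *)
Lemma neighbors_cut_swap_inl (x : G) :
  neighbors (inl x : cut_swap) #= neighbors x.
Proof.
pose f y : cut_swap := if pselect (B x <-> B y) then inl y else
  if pselect (B x) then inr (idx x y, false) else inr (idx y x + 2, true).
have -> : neighbors (inl x : cut_swap) = f @` neighbors x.
  apply/seteqP; split=> [[y|[i [|]]]|_ [y xy <-]]; rewrite /neighbors /=.
  - move=> h; have [xy xyB] : adj x y /\ (B x <-> B y).
      by case: h => -[xy xyB]; [|split; [exact: adj_sym|tauto]].
    by exists y => //; rewrite /f; case: (pselect (B x <-> B y)).
  - case=> // -[y yx <-]; have [By nBx yxadj] := yx.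
    exists y; first exact: adj_sym.
    rewrite /f; case: (pselect (B x <-> B y)) => h; last by case: pselect.
    by case: nBx; exact/h.
  - case=> // -[y xy <-]; have [Bx nBy xyadj] := xy.
    exists y => //.
    rewrite /f; case: (pselect (B x <-> B y)) => h; last by case: pselect.
    by case: nBy; exact/h.
  - rewrite /f; case: (pselect (B x <-> B y)) => h; first by left.
    case: pselect => [Bx|nBx]; left.
      by exists y => //; split=> // By; tauto.
    exists y => //; split=> //; [|exact: adj_sym].
    by have := EM (B y); tauto.
apply: inj_card_eq => y z /set_mem xy /set_mem xz; rewrite /f.
case: (pselect (B x <-> B y)) => hy; case: (pselect (B x <-> B z)) => hz;
  try by case: pselect.
  by case.
case: pselect => [Bx|nBx] [].
  by move=> /idx_inj[]//; split=> // ?; tauto.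
have Byz := (EM (B y), EM (B z)).
by move=> /addIr/idx_inj[]//; split=> //; try (exact: adj_sym); tauto.
Qed.

(** The map [f] numbers the neighbours by their offsets [c < D]. A vertex of [G] gets the number 2,
    the offset of the bipartite edge given up for it. *)
Lemma neighbors_cut_swap_inr (t : int * bool) :
  neighbors (inr t : cut_swap) #= `I_D.
Proof.
case: t => i [].
  pose f (a : cut_swap) : nat := if a is inr (k, _) then `|i - k|%N else 2.
  suff <- : f @` neighbors (inr (i, true) : cut_swap) = `I_D.
    rewrite card_eq_sym; apply: inj_card_eq => a b /set_mem + /set_mem.
    case: a => [x|[j []]]; case: b => [y|[k []]];
      rewrite /neighbors /mkset /adj /= /swap_adj /=; try by [case|move=> _ []].
    - case=> // -[x' xx' xi] [] // -[y' yy' yi] _; congr inl.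
      by have [|_ ->] := idx_inj xx' yy'; [lia|].
    (* A vertex of [G] and a bipartite neighbour never share the number 2: the cut edge that yields
       the former excludes the bipartite edge to the latter. *)
    - case=> // -[x' xx' xi] [] // [c [cD ic c2]] /= c2'.
      by exfalso; apply: c2; [lia|exists x', x; split=> //; lia].
    - move=> + []// [x' xx' xi] => -[]// [c [cD ic c2]] /= c2'.
      by exfalso; apply: c2; [lia|exists x', y; split=> //; lia].
    - move=> []// [c [cD ic c2]] []// [d [dD id d2]] h; congr (inr (_, _)); lia.
  apply/seteqP; split=> [_ [[x|[j []]] + <-]|c cD];
    rewrite /neighbors /mkset /adj /= /swap_adj /=.
  - by lia.
  - by case.
  - by case=> // -[c [cD -> _]]; lia.
  - have [[c2 [x [y [xy xyi]]]]|h] :=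
        EM (c = 2 /\ exists x y, cut_edge x y /\ idx x y = i - 2).
      exists (inl y); last by rewrite c2.
      by right; exists x => //; lia.
    exists (inr (i - c%:Z, false)); last by rewrite /=; lia.
    right; exists c; split=> //; first by lia.
    move=> c2 [x [y [xy xyi]]]; apply: h; split=> //.
    by exists x, y; split=> //; lia.
(* On this side the relevant cut edge has index [i] itself instead of [i - 2]. *)
pose f (a : cut_swap) : nat := if a is inr (k, _) then `|i - k|%N else 2.
suff <- : f @` neighbors (inr (i, false) : cut_swap) = `I_D.
  rewrite card_eq_sym; apply: inj_card_eq => a b /set_mem + /set_mem.
  case: a => [x|[j []]]; case: b => [y|[k []]];
    rewrite /neighbors /mkset /adj /= /swap_adj /=; try by [case|move=> _ []].
  - case=> // -[x' xx' xi] [] // -[y' yy' yi] _; congr inl.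
    by have [|->] := idx_inj xx' yy'; [lia|].
  - case=> // -[x' xx' xi] [] // [c [cD ic c2]] /= c2'.
    by exfalso; apply: c2; [lia|exists x, x'; split=> //; lia].
  - move=> + []// [x' xx' xi] => -[]// [c [cD ic c2]] /= c2'.
    by exfalso; apply: c2; [lia|exists y, x'; split=> //; lia].
  - move=> []// [c [cD ic c2]] []// [d [dD id d2]] h; congr (inr (_, _)); lia.
apply/seteqP; split=> [_ [[x|[j []]] + <-]|c cD];
    rewrite /neighbors /mkset /adj /= /swap_adj /=.
- by lia.
- by case=> // -[c [cD -> _]]; lia.
- by case.
- have [[c2 [x [y [xy xyi]]]]|h] :=
      EM (c = 2 /\ exists x y, cut_edge x y /\ idx x y = i).
    exists (inl x); last by rewrite c2.
    by right; exists y => //; lia.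
  exists (inr (i + c%:Z, true)); last by rewrite /=; lia.
  left; exists c; split=> //.
  move=> c2 [x [y [xy xyi]]]; apply: h; split=> //.
  by exists x, y; split=> //; lia.
Qed.

End cut_swap.

(** * Connectivity of the exchanged graph *)

Section connectivity.
Variables (G : graph) (B : set G) (idx : G -> G -> int) (D : nat) (x0 : G).
Hypotheses (D3 : (3 <= D)%N) (Bx0 : B x0) (Gconn : connected_graph G).
Notation H := (cut_swap B idx D).
Implicit Types (a b : H).

Let in_B a := exists2 x, B x & a = inl x.

(* Only the edges inside [B] are not assumed to be respected by [E]; applied to
   connectivity after the removal of one such edge. *)
Lemma cut_swap_rel (E : H -> H -> Prop) :
  (forall a, E a a) -> (forall a b, E a b -> E b a) ->
  (forall b a c, E a b -> E b c -> E a c) ->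
  (forall a b, adj a b -> ~ (in_B a /\ in_B b) -> E a b) ->
  (forall t t', E (inr t) (inr t')) /\
  (forall x t, ~ B x -> E (inl x) (inr t)).
Proof.
move=> Erefl Esym Etrans Eadj.
have step i (c : nat) : (c < 2)%N -> E (inr (i, false)) (inr (i + c%:Z, true)).
  move=> c2; apply: Eadj; last by case=> _ [].
  by left; exists c; split=> //; lia.
(* Offset 1 leads to [(i + 1, true)], and offset 0 leads back from there to [(i + 1, false)]. *)
have succ i : E (inr (i, false)) (inr (i + 1, false)).
  apply: (Etrans (inr (i + 1, true))); first exact: (step i 1%N).
  by apply: Esym; have := step (i + 1) 0%N isT; rewrite addr0.
have base i : E (inr (i, false)) (inr (0, false)).
  elim/int_ind: i => [|n IHn|n IHn]; first exact: Erefl.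
    by apply: Etrans IHn; apply: Esym; have := succ n; rewrite -PoszD addn1.
  apply: Etrans IHn; have := succ (- n.+1%:Z).
  by rewrite (_ : - n.+1%:Z + 1 = - n%:Z)//; lia.
have Ebase t : E (inr t) (inr (0, false)).
  case: t => i [|] //; apply: Etrans (base i); apply: Esym.
  by have := step i 0%N isT; rewrite addr0.
have Et t t' : E (inr t) (inr t') by apply: Etrans (Esym _ _ (Ebase t')).
(* Induction along a walk from [x0] to [x]. If the vertex [z] before [x] is in [B], then [zx] is a
   cut edge and links [x] to the bipartite graph; otherwise the edge [zx] is kept and [z] is already
   linked. *)
split=> // x t nBx; have [n] := Gconn x0 x; elim: n x nBx => [x nBx xE|].
  by case: nBx; rewrite -xE.
move=> n IHn x nBx [z wz zx]; have [Bz|nBz] := EM (B z).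
  apply: (Etrans (inr (idx z x + 2, true))); last exact: Et.
  apply: Eadj; last by case=> _ [].
  by left; exists z.
apply: Etrans (IHn z nBz wz); apply: Eadj.
  by left; split; [exact: adj_sym|tauto].
by case=> _ [y By [zy]]; apply: nBz; rewrite zy.
Qed.

(** Where a walk of [G] crosses the cut, a detour through the bipartite graph replaces the lost
    edge. The vertex [y0] guarantees that [G] and the bipartite graph are linked at all. *)
Lemma cut_swap_connected y0 : ~ B y0 -> connected_graph H.
Proof.
move=> nBy0; pose E : H -> H -> Prop := fun a b => component a b.
have [Et Eout] := @cut_swap_rel E (@component_refl _) (@component_sym _)
  (@component_trans _) (fun a b ab _ => adj_component ab).
pose t0 : int * bool := (0, false).
have Eadj x y : adj x y -> E (inl x) (inl y).
  move=> xy; have [xyB|nxyB] := EM (B x <-> B y).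
    by apply: adj_component; left.
  have cross u v : cut_edge B u v -> E (inl u) (inr t0).
    move=> uv; pose a : H := inr (idx u v, false).
    apply: (@component_trans H a); last exact: Et.
    by apply: adj_component; left; exists v.
  have [Bx|nBx] := EM (B x).
    have nBy : ~ B y by tauto.
    apply: (component_trans (cross x y _)) => //.
    by apply: component_sym; exact: Eout.
  have By : B y by have := EM (B y); tauto.
  apply: (component_trans (Eout x t0 nBx)); apply: component_sym.
  by apply: (cross y x); split=> //; exact: adj_sym.
have Einl x y : E (inl x) (inl y).
  have [n] := Gconn x y; elim: n y => [y ->|n IHn y [z /IHn xz zy]].
    exact: component_refl.
  by apply: component_trans xz _; exact: Eadj.
suff Ebase a : E a (inr t0).
  by move=> a b; exact: component_trans (Ebase a) (component_sym (Ebase b)).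
case: a => [x|t]; last exact: Et.
by apply: component_trans (Einl x y0) _; exact: Eout.
Qed.

(** If all components are infinite, none fits into [B], so each reaches the bipartite graph and
    there is only one. *)
Lemma cut_swap_no_bridge u v : finite_set B -> in_B u -> in_B v ->
  @two_way_infinite_bridge H u v -> False.
Proof.
move=> Bfin uB vB [[uv nconn] inf_comp].
pose E : H -> H -> Prop := fun a b => @component (del_edge u v) a b.
have [] := @cut_swap_rel E (@component_refl (del_edge u v))
  (@component_sym (del_edge u v)) (@component_trans (del_edge u v)).
  move=> a b ab nB; apply: adj_component; split=> //.
  by move=> h; apply: nB; case: h => -[-> ->].
move=> Et Eout; pose t0 : int * bool := (0, false).
suff Ebase a : E a (inr t0).
  apply: nconn => a b.
  exact: component_trans (Ebase a) (component_sym (Ebase b)).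
case: a => [x|t]; last exact: Et.
apply: contrapT => nE; apply: (inf_comp (inl x)).
apply: (@sub_finite_set _ _ [set inl y | y in B]); last exact: finite_image.
move=> [y|t] xy; last by case: nE; exact: component_trans xy (Et _ _).
have [By|nBy] := EM (B y); first by exists y.
by case: nE; apply: component_trans xy (Eout _ _ nBy).
Qed.

End connectivity.

(** * Density: a prescribed ball without two-way infinite bridges inside it *)

Lemma finite_eventually (T : Type) (A : set T) (P : nat -> T -> Prop) :
  finite_set A -> (forall m n x, (m <= n)%N -> P m x -> P n x) ->
  (forall x, A x -> exists n, P n x) -> exists n, forall x, A x -> P n x.
Proof.
move=> + Pmono; rewrite (@finite_seqP {classic T}) => -[s ->].
elim: s => [|a s IHs] AP; first by exists 0%N.
have [|n nP] := IHs.
  by move=> x xs; apply: AP; rewrite /= in_cons xs orbT.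
have [|m mP] := AP a; first by rewrite /= mem_head.
exists (maxn m n) => x /=; rewrite in_cons => /predU1P[->|xs].
  by apply: Pmono mP; exact: leq_maxl.
by apply: Pmono (nP x xs); exact: leq_maxr.
Qed.

Lemma neighbors_finite D (G : graph) (x : G) :
  max_degree_le D G -> finite_set (neighbors x).
Proof. by move=> /(_ x)/card_le_finite; apply; exact: finite_II. Qed.

(** Finitely many vertices of finite degree have finitely many cut edges, and the position in a list
    of them serves as the index. *)
Lemma cut_edge_index (G : graph) (B : set G) : finite_set B ->
  (forall x : G, finite_set (neighbors x)) ->
  exists idx : G -> G -> int, forall x y x' y',
    cut_edge B x y -> cut_edge B x' y' -> idx x y = idx x' y' ->
    x = x' /\ y = y'.
Proof.
move=> Bfin Gfin.
have : finite_set [set p : G * G | cut_edge B p.1 p.2].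
  apply: (@sub_finite_set _ _ (\bigcup_(x in B) (pair x @` neighbors x))).
    by move=> [x y] [/= Bx _ xy]; exists x => //; exists y.
  by apply: bigcup_finite => // x _; exact: finite_image.
move=> /(@finite_seqP {classic (G * G)})[s sE].
have mem_s x y : cut_edge B x y -> ((x, y) : {classic (G * G)}) \in s.
  by move=> xy; have : [set p | cut_edge B p.1 p.2] (x, y) by []; rewrite sE.
exists (fun x y => (index ((x, y) : {classic (G * G)}) s)%:Z).
move=> x y x' y' /mem_s xy /mem_s x'y' [xyE].
have := congr1 (nth ((x, y) : {classic (G * G)}) s) xyE.
by rewrite !nth_index // => -[].
Qed.

Lemma no_bridge_dense D (G : crgraph D) r : (3 <= D)%N -> infinite_graph G ->
  exists H : crgraph D, [/\ infinite_graph H, regular D G -> regular D H,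
    iso (rball r G) (rball r H) &
    forall u v : H, ball_set r u -> ball_set r v ->
      ~ two_way_infinite_bridge u v].
Proof.
move=> D3 Ginf; have Gconn := crgraph_connected (c := G).
pose B : set G := @ball_set r G.
have Bfin : finite_set B by exact: crgraph_ball_finite.
have Bx0 : B (Defs.root G) by exact: root_in_ball.
have [y0 nBy0] : exists y0, ~ B y0.
  apply: contrapT => BT; apply: Ginf; apply: sub_finite_set Bfin => y _.
  by apply: contrapT => nBy; apply: BT; exists y.
have [idx idx_inj] := cut_edge_index Bfin
  (fun x => neighbors_finite x (crgraph_degree (c := G))).
pose H := cut_swap B idx D.
have Hdeg : max_degree_le D H.
  case=> [x|t].
    rewrite (card_le_eql (neighbors_cut_swap_inl D idx_inj x)).
    exact: crgraph_degree.
  by rewrite (card_le_eql (neighbors_cut_swap_inr D3 idx_inj t)).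
pose K := @CRGraph D (@RGraph H (inl (Defs.root G)))
  (cut_swap_connected D3 Bx0 Gconn nBy0) Hdeg.
have walk_inl n (x : G) : (n <= r)%N ->
    walk n (Defs.root G) x -> walk n (Defs.root K) (inl x).
  elim: n x => [x _ <- //|n IHn x nr [z wz zx]].
  exists (inl z); first by apply: IHn wz; exact: ltnW.
  left; split=> //; split=> _.
    by exists n.+1 => //; exists z.
  by exists n => //; exact: ltnW.
have walk_root n (a : K) : (n <= r)%N -> walk n (Defs.root K) a ->
    exists2 x, walk n (Defs.root G) x & a = inl x.
  elim: n a => [a _ <-|n IHn a nr [c wc ca]]; first by exists (Defs.root G).
  have [||z wz cz] := IHn c => //; first exact: ltnW.
  have Bz : B z by exists n => //; exact: ltnW.
  (* Here [z] is reached in fewer than [r] steps, so its neighbours are all in [B]: a walk of length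
     at most [r] has no time to use a new edge. *)
  have out y : cut_edge B z y -> False.
    by move=> [_ nBy zy]; apply: nBy; exists n.+1 => //; exists z.
  move: ca; rewrite {c wc}cz; case: a => [x|[i []]] [].
  - by move=> [zx _]; exists x => //; exists z.
  - by move=> [/adj_sym zx _]; exists x => //; exists z.
  - by move=> [y [_ nBz]].
  - by [].
  - by move=> [y /out].
  - by [].
have ballP (a : K) : ball_set r a -> exists2 x, B x & a = inl x.
  by move=> [n nr /walk_root[]// x wx ->]; exists x => //; exists n.
exists K; split.
- move=> /(sub_finite_set (@subsetT _ (range (inl : G -> K)))).
  rewrite (eq_finite_set (inj_card_eq _)); first exact: Ginf.
  by move=> x y _ _ [].
- move=> Greg [x|t]; last exact: neighbors_cut_swap_inr.
  exact: card_eq_trans (neighbors_cut_swap_inl D idx_inj x) (Greg x).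
- apply/ball_isoP.
  (* The value at bipartite vertices is a dummy, as none of them lies in the ball. *)
  exists inl, (fun a : K => if a is inl x then x else Defs.root G).
  split=> //.
  + by move=> x [n nr wx]; split=> //; exists n => //; exact: walk_inl.
  + by move=> _ /ballP[x Bx ->].
  + move=> x y Bx By; split=> [xy|]; first by left.
    by move=> [[]|[/adj_sym]].
- move=> u v /ballP uB /ballP vB.
  exact: (cut_swap_no_bridge D3 Bx0 Gconn Bfin uB vB).
Qed.

(** * Stability: the absence of such bridges is seen in a finite ball *)

Section detection.
Variables (D n : nat) (G : crgraph D) (u v : G).
Hypotheses (un : ball_set n u) (vn : ball_set n v).

(** A walk of length [m] from [u] stays in the ball of radius [n + m], so [f] transports it;
    injectivity of [f] there keeps the image off the edge from [f u] to [f v]. *)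
Lemma ball_iso_connected_del m (G' : crgraph D) f g :
  @walk (del_edge u v) m u v -> @ball_iso (n + m) G G' f g ->
  @component (del_edge (f u) (f v)) (f u) (f v).
Proof.
move=> wm fg; have [fP gP fadj fr] := fg.
have injf x y : ball_set (n + m) x -> ball_set (n + m) y -> f x = f y -> x = y.
  by move=> /fP[_ {2}<-] /fP[_ {2}<-] ->.
have un' : ball_set (n + m) u by apply: ball_set_mono un; exact: leq_addr.
have vn' : ball_set (n + m) v by apply: ball_set_mono vn; exact: leq_addr.
have ball k x : (k <= m)%N -> @walk (del_edge u v) k u x -> ball_set (n + k) x.
  elim: k x => [x _ <-|k IHk x km [z wz [zx _]]]; first by rewrite addn0.
  have [j jk wj] := IHk z (ltnW km) wz; exists j.+1; last by exists z.
  by rewrite addnS.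
suff : forall k x, (k <= m)%N -> @walk (del_edge u v) k u x ->
    @component (del_edge (f u) (f v)) (f u) (f x).
  by move=> /(_ m v (leqnn m) wm).
elim=> [x _ <-|k IHk x km w]; first exact: component_refl.
have [z wz [zx nuv]] := w.
have xb := ball_set_mono (leq_add (leqnn n) km) (ball _ _ km w).
have zb := ball_set_mono (leq_add (leqnn n) (ltnW km)) (ball _ _ (ltnW km) wz).
apply: component_trans (IHk z (ltnW km) wz) _; apply: adj_component.
split; first exact/fadj.
by move=> h; apply: nuv; case: h => -[/injf zE /injf xE]; [left|right]; split;
  (exact: zE || exact: xE).
Qed.

(** The image of the finite component under [f] is closed under adjacency, so it contains the
    component of [f x]. *)
Lemma ball_iso_finite_component m x (G' : crgraph D) f g :
  @component (del_edge u v) x `<=` @ball_set m G ->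
  @ball_iso (maxn m n).+1 G G' f g ->
  finite_set (@component (del_edge (f u) (f v)) (f x)).
Proof.
move=> Cm fg; have [fP gP fadj fr] := fg.
have ms : (m <= (maxn m n).+1)%N by lia.
have Cfin : finite_set (@component (del_edge u v) x).
  exact: sub_finite_set Cm (crgraph_ball_finite _ _).
apply: sub_finite_set (finite_image f Cfin).
apply: (@component_sub (del_edge (f u) (f v))).
  by exists x => //; exact: component_refl.
move=> _ z [c xc <-] [cz nuv]; have cm := Cm _ xc.
(* The radius exceeds [m], so a neighbour [z] of [f c] is still in the ball and can be pulled back
   by [g]. *)
have zs : ball_set (maxn m n).+1 z.
  have [j jm wj] := ball_iso_ball ms fg cm; exists j.+1; last by exists (f c).
  by lia.
have [gzs fgz] := gP z zs; exists (g z) => //.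
apply: component_trans xc _; apply: adj_component; split.
  by apply/fadj => //; [exact: ball_set_mono cm|rewrite fgz].
move=> h; apply: nuv; rewrite -fgz.
by case: h => -[-> ->]; [left|right].
Qed.

(** Three cases: no edge, a walk around the edge, or a finite component. *)
Lemma no_bridge_stable_pair : ~ two_way_infinite_bridge u v ->
  exists s, forall (G' : crgraph D) f g, @ball_iso s G G' f g ->
    ~ two_way_infinite_bridge (f u) (f v).
Proof.
move=> nuv; have [uv|nadj] := EM (adj u v); last first.
  exists n => G' f g [_ _ fadj _] [[/fadj uv _] _].
  by apply: nadj; exact: uv.
have [conn|nconn] := EM (connected_graph (del_edge u v)).
  have [m wm] := conn u v; exists (n + m)%N => G' f g fg [br _].
  apply: bridge_separates (br) _; first exact: crgraph_connected.
  exact: ball_iso_connected_del wm fg.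
have [x xfin] : exists x : del_edge u v, finite_set (component x).
  apply: contrapT => h; apply: nuv; split=> // x xfin.
  by apply: h; exists x.
have [m Cm] : exists m, forall y,
    @component (del_edge u v) x y -> @ball_set m G y.
  apply: finite_eventually xfin _ _.
    by move=> m m' y /ball_set_mono; apply.
  by move=> y _; have [k w] := crgraph_connected (Defs.root G) y; exists k, k.
exists (maxn m n).+1 => G' f g fg [_ /(_ (f x))]; apply.
exact: ball_iso_finite_component Cm fg.
Qed.

End detection.

Lemma no_bridge_stable D n (G : crgraph D) :
  (forall u v : G, ball_set n u -> ball_set n v ->
    ~ two_way_infinite_bridge u v) ->
  exists s, forall G' : crgraph D, iso (rball s G) (rball s G') ->
    forall u v : G', ball_set n u -> ball_set n v ->
      ~ two_way_infinite_bridge u v.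
Proof.
move=> nG; pose A := [set p : G * G | ball_set n p.1 /\ ball_set n p.2].
have Afin : finite_set A.
  by apply: (finite_setX (A := @ball_set n G) (B := @ball_set n G));
    exact: crgraph_ball_finite.
have [m mP] : exists m, forall p, A p -> forall (G' : crgraph D) f g,
    @ball_iso m G G' f g -> ~ two_way_infinite_bridge (f p.1) (f p.2).
  apply: finite_eventually Afin _ _.
    by move=> k l p kl kP G' f g /(ball_iso_mono kl); exact: kP.
  move=> [u v] [/= un vn].
  by have [s sP] := no_bridge_stable_pair un vn (nG _ _ un vn); exists s.
(* Radius [m] serves all pairs at once; radius [n] makes each pair in the [n]-ball of [G'] the image
   of a pair in that of [G]. *)
exists (maxn m n) => G' /ball_isoP[f [g fg]] u v un vn.
have gf := ball_iso_sym (ball_iso_mono (leq_maxr m n) fg).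
have [gP _ _ _] := gf.
have [gun fgu] := gP u un; have [gvn fgv] := gP v vn.
have := mP (g u, g v) (conj gun gvn) G' f g (ball_iso_mono (leq_maxl m n) fg).
by rewrite /= fgu fgv.
Qed.

(** * Open sets of the metric and meagerness *)

Section topology.
Variables (R : realType) (D : nat).
Implicit Types c : rooted_graphs R D.

Lemma mdist_repr c c' : mdist c c' = rgraph_dist R (repr c) (repr c').
Proof. by rewrite -{1}(reprK c) -{1}(reprK c') mdist_pi. Qed.

Lemma open_iso_ball s (G : Defs.rgraph) :
  open [set c : rooted_graphs R D | iso (rball s (repr c)) (rball s G)].
Proof.
rewrite openE => c /= cG; apply/nbhs_ballP; exists (2 ^- s).
  by rewrite /= invr_gt0 exprn_gt0.
move=> c'; rewrite ballEmdist /= mdist_repr => /rgraph_dist_lt[r rs i].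
apply: iso_trans cG; apply: iso_sym; apply: iso_ball_mono i.
rewrite leqNgt; apply/negP => sr; move: rs; apply/negP; rewrite -leNgt.
by rewrite lef_pV2 ?posrE ?exprn_gt0// ler_eXn2l ?ltr1n// ltnW.
Qed.

Lemma open_contains_iso_ball (U : set (rooted_graphs R D)) c : open U -> U c ->
  exists r, forall c', iso (rball r (repr c)) (rball r (repr c')) -> U c'.
Proof.
rewrite openE => oU /oU/nbhs_ballP[e /= e0 eU].
(* For this [r], [e^-1 < r < 2 ^ r], hence [2 ^- r < e]. *)
exists (Num.bound e^-1) => c' /(rgraph_dist_le R) d; apply: eU.
rewrite ballEmdist /= mdist_repr; apply: le_lt_trans d _.
rewrite invf_plt ?posrE ?exprn_gt0//.
apply: (lt_trans (archi_boundP _)); first by rewrite invr_ge0 ltW.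
by rewrite -natrX ltr_nat ltn_expl.
Qed.

(** Properties of a class are read off its representative, which is only isomorphic to the graph
    constructed. *)
Lemma repr_pi_iso (G : crgraph D) : iso (repr (\pi_(rooted_graphs R D) G)) G.
Proof. by apply/(rooted_graphs_eqP R); rewrite reprK. Qed.

Lemma meager_two_way_infinite_bridge (X : set (rooted_graphs R D)) :
  (forall c r, X c -> exists H : crgraph D,
    [/\ X (\pi H), iso (rball r (repr c)) (rball r H) &
        forall u v : H, ball_set r u -> ball_set r v ->
          ~ two_way_infinite_bridge u v]) ->
  meager (with_two_way_infinite_bridge X).
Proof.
move=> dense; exists (fun n => [set c : X | exists u v : repr (\val c),
  [/\ ball_set n u, ball_set n v & two_way_infinite_bridge u v]]); split.
  move=> n U [V oV <-] [c Vc].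
  have [r rV] := open_contains_iso_ball oV Vc.
  (* Agreement up to radius [r] keeps the class of [H] in [V]; radius [n] excludes the bridges
     counted by the [n]-th set. *)
  have [H [XH iH nH]] := dense (\val c) (maxn r n) (set_valP c).
  have [s sH] := no_bridge_stable nH.
  pose t := maxn s (maxn r n).
  pose W := [set c' : rooted_graphs R D | iso (rball t (repr c')) (rball t H)].
  exists [set c' : X | W (\val c')]; split.
  - by exists W => //; exact: open_iso_ball.
  - exists (exist _ (\pi H) (mem_set XH) : X).
    exact/iso_ball/repr_pi_iso.
  - move=> c' /= i; apply: rV.
    apply: iso_trans (iso_ball_mono (leq_maxl r n) iH) _.
    apply: iso_sym; apply: iso_ball_mono i.
    by rewrite /t; lia.
  - rewrite -subset0 => c' [/= i [u [v [un vn uv]]]].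
    have nr := leq_maxr r n; have st := leq_maxl s (maxn r n).
    exact: (sH _ (iso_sym (iso_ball_mono st i)) u v (ball_set_mono nr un)
      (ball_set_mono nr vn)).
apply/seteqP; split=> [c [u [v uv]]|c [n _ [u [v [_ _ uv]]]]]; last first.
  by exists u, v.
(* Connectedness puts both ends of a bridge at finite distance from the root, so the union over [n]
   is everything. *)
have [m mu] := crgraph_connected (Defs.root (repr (\val c))) u.
have [k kv] := crgraph_connected (Defs.root (repr (\val c))) v.
exists (maxn m k) => //; exists u, v; split=> //.
  by exists m => //; exact: leq_maxl.
by exists k => //; exact: leq_maxr.
Qed.

End topology.

(** * Invariance under isomorphism, and the two spaces *)

Lemma iso_infinite (G H : Defs.rgraph) :
  iso G H -> infinite_graph G -> infinite_graph H.
Proof.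
move=> [f [[g fK gK] _ _]] Ginf Hfin; apply: Ginf.
by apply: sub_finite_set (finite_image g Hfin) => x _; exists (f x).
Qed.

Lemma iso_regular D (G H : Defs.rgraph) : iso G H -> regular D G -> regular D H.
Proof.
move=> [f [[g fK gK] fadj _]] Greg x.
apply: card_eq_trans (Greg (g x)).
have -> : neighbors x = f @` neighbors (g x).
  apply/seteqP; split=> [y xy|_ [y xy <-]].
    by exists (g y); rewrite ?gK //; apply/fadj; rewrite !gK.
  by rewrite -(gK x); apply/fadj.
by apply: inj_card_eq => y z _ _ /(can_inj fK).
Qed.

Theorem corollary3p9 (R : realType) (D : nat) (hD : (3 <= D)%N) :
  meager (with_two_way_infinite_bridge (infinite_rooted_graphs R D)) /\
  meager (with_two_way_infinite_bridge (infinite_regular_rooted_graphs R D)).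
Proof.
split; apply: meager_two_way_infinite_bridge => c r.
  move=> /(no_bridge_dense r hD)[H [Hinf _ i nH]]; exists H; split=> //.
  exact: iso_infinite (iso_sym (repr_pi_iso R H)) Hinf.
move=> [/(no_bridge_dense r hD)[H [Hinf Hreg i nH]] creg].
exists H; split=> //; split.
  exact: iso_infinite (iso_sym (repr_pi_iso R H)) Hinf.
exact: iso_regular (iso_sym (repr_pi_iso R H)) (Hreg creg).
Qed.
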